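(* Let $C\subseteq\mathbb{R}^n$ be closed, convex, and either nonnegative type-1 symmetric or type-2 symmetric, let $f:\mathbb{R}^n\to\mathbb{R}$ be twice continuously differentiable with $g=\nabla f$, and let $\{(x^{(j)},y^{(j)})\}_{j\in\mathbb{N}_0}$ be the accepted outer iterates produced by Algorithm PD-QN (described in the context). Put $\zeta:=\max\{\|x\|:x\in C\}$ if $C$ is bounded, and let $\zeta\ge 1$ be a fixed number if $C$ is unbounded. Suppose there are constants $0<\lambda_{\min}\le\lambda_{\max}$, $\gamma>0$, $c>0$ such that: (1) for every $j\in\mathbb{N}_0$ all eigenvalues of $\mathbf{H}^{(j)}$ lie in $[\lambda_{\min},\lambda_{\max}]$; (2) $\|g(x)\|\le\gamma$ whenever $\|x\|\le c\zeta$, and $\|g(x)\|\le\gamma\|x\|$ whenever $\|x\|>c\zeta$; (3) $0<\rho_{\min}\le\rho^{(j)}\le\rho_{\max}<\infty$ for all $j$, $\rho_{\min}>\lambda_{\max}+\gamma-\lambda_{\min}$ (equivalently $0<\bar\theta<1$), and $\bar\kappa<c(1-\bar\theta)$, where $\bar\theta:=\frac{\lambda_{\max}+\gamma}{\lambda_{\min}+\rho_{\min}}$ and $\bar\kappa:=\max\left\{1,\frac{\rho_{\min}+\gamma}{\lambda_{\min}+\rho_{\min}},\frac{\rho_{\min}+\gamma/\zeta}{\lambda_{\min}+\rho_{\min}}\right\}$. Assume further that: (i) there is a compact set $\mathcal{K}$ with $\{(x^{(j)},y^{(j)})\}_{j\in\mathbb{N}_0}\subset\mathcal{K}$; (ii)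 with $F_j(x,y):=\Phi_{(\rho^{(j-1)},x^{(j-1)})}(x,y)$ and $\Psi^{(j)}:=F_j(x^{(j)},y^{(j)})$ for $j\ge1$, the tolerance sequence $\{\varepsilon_j\}$ of the algorithm is summable and there exist constants $\delta>0$, $\kappa\ge0$ such that for all $j\ge1$ $$\Psi^{(j)}-\Psi^{(j+1)}\ge\delta\|x^{(j+1)}-x^{(j)}\|^2,\qquad \|\nabla F_j(x^{(j)},y^{(j)})\|\le\kappa\|x^{(j)}-x^{(j-1)}\|+\varepsilon_{j-1};$$ (iii) $\|x^{(j)}-y^{(j)}\|\to0$ as $j\to\infty$. Then the sequence $\{(x^{(j)},y^{(j)})\}_{j\in\mathbb{N}_0}$ converges to a single limit $(x^*,y^* )$. Moreover $x^*=y^*$, and $x^*$ is a basic feasible (BF) point and a CC-M stationary point of $\min_{x\in C\cap C_s}f(x)$.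
   Context: Notation. $\|\cdot\|$ is the Euclidean norm, $[n]=\{1,\dots,n\}$, $\|x\|_0$ is the number of nonzero components of $x$, $I_1(x)=\{i\in[n]:x_i\ne0\}$, $s<n$ is a positive integer, $C_s=\{x\in\mathbb{R}^n:\|x\|_0\le s\}$. The problem is $\min_{x\in C\cap C_s}f(x)$. A closed convex set $C$ is type-1 symmetric if it is invariant under all permutations of coordinates; nonnegative if all its elements have nonnegative components; type-2 symmetric if it is type-1 symmetric and invariant under all coordinatewise sign changes. Put $p(x)=x$ if $C$ is nonnegative type-1 symmetric and $p(x)=|x|$ (componentwise) if $C$ is type-2 symmetric. A sorting permutation of $v\in\mathbb{R}^n$ is a permutation $\pi$ of $[n]$ with $v_{\pi(1)}\ge\dots\ge v_{\pi(n)}$; $S^\pi_{[i,n]}=\{\pi(i),\dots,\pi(n)\}$ for $i\le n$ and $S^\pi_{[n+1,n]}=\emptyset$. Model. $\Phi_{(\rho,z)}(x,y)=(x-z)^Tg(z)+\frac12(x-z)^T\mathbf{H}(x-z)+\frac12\rho\|x-y\|^2$, where for $z=x^{(j)}$ the matrix $\mathbf{H}$ is $\mathbf{H}^{(j)}$. $\nabla F_j$ denotes the gradient with respect to the joint variable $(x,y)$; $\nabla_x$ the partial gradient in $x$. Algorithm PD-QN. Parameters: $r>1$, $\hat c>0$, $\rho_{\max}>\rho^{(0)}>\rho_{\min}>0$, $\tau\in(0,1)$, sequences $\varepsilon_j\downarrow0$, $\eta_j\downarrow0$. Input: symmetric positive definite $\mathbf{H}^{(0)}$, $x^{(0)}=x^{(0)}_0\in\mathbb{R}^n$,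 $y^{(0)}=y^{(0)}_0\in C\cap C_s$. Choose $\Upsilon^{(0)}\ge\max\{f(x^{(0)}_0),\min_x\Phi_{(\rho^{(0)},x^{(0)})}(x,y^{(0)}_0),\hat c\}$. For $j=1,2,\dots$: (a) Inner loop: for $\ell=1,2,\dots$: let $x^{(j-1)}_\ell=\operatorname{argmin}_{x\in\mathbb{R}^n}\Phi_{(\rho^{(j-1)},x^{(j-1)})}(x,y^{(j-1)}_{\ell-1})$; choose a sorting permutation $\pi$ of $-p(-\nabla_x\Phi_{(\rho^{(j-1)},x^{(j-1)})}(x^{(j-1)}_\ell,y^{(j-1)}_{\ell-1}))$ and $i\in[n+1]$ such that $\mathcal{L}_\ell:=I_1(y^{(j-1)}_{\ell-1})\cup S^\pi_{[i,n]}$ has exactly $s$ elements; let $y^{(j-1)}_\ell=\operatorname{argmin}\{\Phi_{(\rho^{(j-1)},x^{(j-1)})}(x^{(j-1)}_\ell,y):y\in C\cap C_s,\ I_1(y)\subseteq\mathcal{L}_\ell\}$; stop the inner loop as soon as $\|\nabla_x\Phi_{(\rho^{(j-1)},x^{(j-1)})}(x^{(j-1)}_\ell,y^{(j-1)}_\ell)\|\le\varepsilon_{j-1}$. (b) Set $\rho^{(j)}=\max(\rho_{\min},\min(r\rho^{(j-1)},\rho_{\max}))$ and $(x^{(j)},y^{(j)})=(x^{(j-1)}_\ell,y^{(j-1)}_\ell)$ for the final $\ell$. (c) A restart is triggered if $\min_x\Phi_{(\rho^{(j)},x^{(j)})}(x,y^{(j)})>\Upsilon^{(j-1)}$ or if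 $\|x^{(j)}-y^{(j)}\|>\tau\|x^{(j-1)}-y^{(j-1)}\|+\eta_j$. If a restart is triggered set $y^{(j)}_0=y^{(0)}_0$; otherwise set $y^{(j)}_0=y^{(j)}$. (d) Set $\Upsilon^{(j)}=\max\{\Upsilon^{(j-1)},f(x^{(j)}),\min_x\Phi_{(\rho^{(j)},x^{(j)})}(x,y^{(j)}_0)\}$ and choose a new symmetric positive definite matrix $\mathbf{H}^{(j)}$. Stationarity. For $\mathcal{L}\subseteq[n]$, $x_{\mathcal{L}}$ is the subvector indexed by $\mathcal{L}$, $U_{\mathcal{L}}$ the matrix of the columns of the identity indexed by $\mathcal{L}$, $C_{\mathcal{L}}=\{w\in\mathbb{R}^{|\mathcal{L}|}:U_{\mathcal{L}}w\in C\}$, $g_{\mathcal{L}}(x)=U_{\mathcal{L}}^Tg(x)$, and $P_S$ is Euclidean projection onto $S$. A super support of $x\in C\cap C_s$ is a set $\mathcal{L}$ with $I_1(x)\subseteq\mathcal{L}$, $|\mathcal{L}|=s$. $x\in C\cap C_s$ is a BF point if for every super support $\mathcal{L}$ of $x$ there is $L>0$ with $x_{\mathcal{L}}=P_{C_{\mathcal{L}}}(x_{\mathcal{L}}-\frac1Lg_{\mathcal{L}}(x))$. For a closed set $S$ and $\bar x\in S$: the Fréchet normal cone is $N^F_S(\bar x)=\{v:\limsup_{x\to\bar x,\,x\in S\setminus\{\bar x\}}\langle v,x-\bar x\rangle/\|x-\bar x\|\le0\}$; the Mordukhovich normal cone $N_S(\bar x)$ is the set of limits of sequences $v^k\in N^F_S(x^k)$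 with $x^k\in S$, $x^k\to\bar x$. A point $\bar x\in C\cap C_s$ is CC-M stationary if $0\in g(\bar x)+N_C(\bar x)+N_{C_s}(\bar x)$. *)

(* Defs.v *)
(* R^n is 'cV[R]_n over an arbitrary realType R; coordinates are numbered from 0,
   so [n] = {1, .., n} is 'I_n. *)
From HB Require Import structures.
From mathcomp Require Import all_boot all_order all_algebra perm.
From mathcomp Require Import all_classical all_reals all_analysis.

Set Implicit Arguments.
Unset Strict Implicit.
Unset Printing Implicit Defensive.

Import Order.TTheory GRing.Theory Num.Theory.
Import numFieldNormedType.Exports.

Local Open Scope classical_set_scope.
Local Open Scope ring_scope.

(* The norm `|x| that MathComp-Analysis puts on 'cV[R]_n is the max norm, hence
   the separate Euclidean norm enorm.  The two norms induce the same topology,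
   the same bounded sets and the same notion of differentiability. *)
Definition dot (R : realType) (n : nat) (u v : 'cV[R]_n) : R :=
  (u^T *m v) 0 0.

Definition enorm (R : realType) (n : nat) (u : 'cV[R]_n) : R :=
  Num.sqrt (dot u u).

(* The set of minimizers; "u = argmin" is rendered by argmin A h u.  Wherever it
   is used below, A is convex (for vectors whose support is confined to a set of
   s indices, membership in C_s is automatic) and h, or its square when h is a
   distance, is strictly convex, so that there is at most one minimizer. *)
Definition argmin (R : realType) (T : Type) (A : set T) (h : T -> R) : set T :=
  [set u | A u /\ forall w, A w -> h u <= h w].

Definition grad (R : realType) (n : nat) (h : 'cV[R]_n -> R) (x : 'cV[R]_n) :
  'cV[R]_n := \col_i 'D_(delta_mx i 0) h x.

Definition hess (R : realType) (n : nat) (h : 'cV[R]_n -> R) (x : 'cV[R]_n) :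
  'M[R]_n :=
  \matrix_(i, j) 'D_(delta_mx j 0) (fun u => grad h u i 0) x.

Definition twice_continuously_differentiable (R : realType) (n : nat)
    (h : 'cV[R]_n -> R) : Prop :=
  [/\ forall x, differentiable h x,
      forall x, differentiable (grad h) x
    & continuous (hess h)].

Definition I1 (R : realType) (n : nat) (x : 'cV[R]_n) : {set 'I_n} :=
  [set i | x i 0 != 0]%SET.

Definition Csparse (R : realType) (n s : nat) : set 'cV[R]_n :=
  [set x | (#|I1 x| <= s)%N].

Definition type1_symmetric (R : realType) (n : nat) (C : set 'cV[R]_n) : Prop :=
  forall (pi : {perm 'I_n}) x, C x -> C (row_perm pi x).

Definition nonnegative_set (R : realType) (n : nat) (C : set 'cV[R]_n) : Prop :=
  forall x, C x -> forall i, 0 <= x i 0.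

Definition type2_symmetric (R : realType) (n : nat) (C : set 'cV[R]_n) : Prop :=
  type1_symmetric C /\
  forall (b : 'I_n -> bool) x, C x -> C (\col_i ((-1) ^+ b i * x i 0)).

(* C is of one of the two admissible kinds, and p is the matching map.  It is a
   relation because both kinds apply to C = {0}, for which either p is allowed. *)
Definition symmetric_with (R : realType) (n : nat) (C : set 'cV[R]_n)
    (p : 'cV[R]_n -> 'cV[R]_n) : Prop :=
  ([/\ type1_symmetric C, nonnegative_set C & p = id]) \/
  (type2_symmetric C /\ p = (fun x => \col_i `|x i 0|)).

Definition sorting_perm (R : realType) (n : nat) (v : 'cV[R]_n)
    (pi : {perm 'I_n}) : Prop :=
  forall a b : 'I_n, (a <= b)%N -> v (pi b) 0 <= v (pi a) 0.

(* i : 'I_n.+1 stands for the one-based index i + 1 in [n + 1]; i = n gives the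
   empty set. *)
Definition perm_tail (n : nat) (pi : {perm 'I_n}) (i : 'I_n.+1) : {set 'I_n} :=
  [set pi k | k : 'I_n & (i <= k)%N]%SET.

Definition posdef_sym (R : realType) (n : nat) (H : 'M[R]_n) : Prop :=
  H^T = H /\ forall u : 'cV[R]_n, u != 0 -> 0 < dot u (H *m u).

Section Model.
Context {R : realType} {n : nat}.
Implicit Types (f : 'cV[R]_n -> R) (H : 'M[R]_n) (rho : R) (z x y : 'cV[R]_n).

Definition Phi f H rho z x y : R :=
  dot (x - z) (grad f z) + 2^-1 * dot (x - z) (H *m (x - z))
  + 2^-1 * rho * enorm (x - y) ^+ 2.

Definition grad_x (F : 'cV[R]_n -> 'cV[R]_n -> R) x y : 'cV[R]_n :=
  grad (fun u => F u y) x.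

Definition grad_xy (F : 'cV[R]_n -> 'cV[R]_n -> R) x y : 'cV[R]_(n + n) :=
  col_mx (grad (fun u => F u y) x) (grad (fun w => F x w) y).

(* The minimum is attained when H is positive definite and 0 < rho. *)
Definition min_Phi f H rho z y : R := inf (range (fun x => Phi f H rho z x y)).

End Model.

Record pdqn_params (R : realType) := PDQNParams {
  par_r : R;
  par_chat : R;
  par_rho_min : R;
  par_rho_max : R;
  par_tau : R;
  par_eps : nat -> R;
  par_eta : nat -> R
}.

(* it_y0 j is y^(j)_0, the starting point of the inner loop that computes the
   outer iterate j + 1; this loop consists of it_len j iterations, and its l-th
   iteration yields x^(j)_l = it_xin j l and y^(j)_l = it_yin j l. *)
Record pdqn_iterates (R : realType) (n : nat) := PDQNIterates {
  it_x : nat -> 'cV[R]_n;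
  it_y : nat -> 'cV[R]_n;
  it_y0 : nat -> 'cV[R]_n;
  it_rho : nat -> R;
  it_H : nat -> 'M[R]_n;
  it_Upsilon : nat -> R;
  it_len : nat -> nat;
  it_xin : nat -> nat -> 'cV[R]_n;
  it_yin : nat -> nat -> 'cV[R]_n
}.

Record valid_params (R : realType) (P : pdqn_params R) (rho0 : R) : Prop := {
  valid_r : 1 < par_r P;
  valid_chat : 0 < par_chat P;
  valid_rho_min : 0 < par_rho_min P;
  valid_rho0 : par_rho_min P < rho0 < par_rho_max P;
  valid_tau : 0 < par_tau P < 1;
  valid_eps : nonincreasing_seq (par_eps P) /\ par_eps P @ \oo --> (0 : R);
  valid_eta : nonincreasing_seq (par_eta P) /\ par_eta P @ \oo --> (0 : R)
}.

Section Algorithm.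
Context {R : realType} {n : nat}.
Variables (s : nat) (C : set 'cV[R]_n) (p : 'cV[R]_n -> 'cV[R]_n).
Variables (f : 'cV[R]_n -> R).

(* One inner iteration for the model F, from yprev to (xnew, ynew). *)
Definition inner_step (F : 'cV[R]_n -> 'cV[R]_n -> R)
    (yprev xnew ynew : 'cV[R]_n) : Prop :=
  argmin setT (fun u => F u yprev) xnew /\
  exists (pi : {perm 'I_n}) (i : 'I_n.+1),
    let L := (I1 yprev :|: perm_tail pi i)%SET in
    [/\ sorting_perm (- p (- grad_x F xnew yprev)) pi,
        #|L| = s
      & argmin [set w | [/\ C w, Csparse s w & I1 w \subset L]]
          (fun w => F xnew w) ynew].

Variables (P : pdqn_params R) (D : pdqn_iterates R n).

(* Phi_(rho^(j), x^(j)), with the matrix H^(j). *)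
Definition model (j : nat) : 'cV[R]_n -> 'cV[R]_n -> R :=
  Phi f (it_H D j) (it_rho D j) (it_x D j).

Definition min_model (j : nat) (y : 'cV[R]_n) : R :=
  min_Phi f (it_H D j) (it_rho D j) (it_x D j) y.

Definition inner_stop (j l : nat) : Prop :=
  enorm (grad_x (model j) (it_xin D j l) (it_yin D j l)) <= par_eps P j.

(* The restart test for the outer iterate j + 1. *)
Definition restart (j : nat) : Prop :=
  it_Upsilon D j < min_model j.+1 (it_y D j.+1) \/
  par_tau P * enorm (it_x D j - it_y D j) + par_eta P j.+1
    < enorm (it_x D j.+1 - it_y D j.+1).

(* D is a run of PD-QN.  The outer step 'j - 1 to j' is indexed here as
   'j to j + 1', for all j >= 0. *)
Record pdqn_run : Prop := {
  run_params : valid_params P (it_rho D 0);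
  run_y_init : it_y0 D 0 = it_y D 0;
  run_y_feas : C (it_y D 0) /\ Csparse s (it_y D 0);
  run_Upsilon_init :
    [/\ f (it_x D 0) <= it_Upsilon D 0,
        min_model 0 (it_y D 0) <= it_Upsilon D 0
      & par_chat P <= it_Upsilon D 0];
  run_H : forall j, posdef_sym (it_H D j);
  run_len : forall j, (0 < it_len D j)%N;
  run_inner_init : forall j, it_yin D j 0 = it_y0 D j;
  run_inner_step : forall j l, (l < it_len D j)%N ->
    inner_step (model j) (it_yin D j l) (it_xin D j l.+1) (it_yin D j l.+1);
  run_inner_continue : forall j l, (0 < l < it_len D j)%N -> ~ inner_stop j l;
  run_inner_stop : forall j, inner_stop j (it_len D j);
  run_rho : forall j, it_rho D j.+1 =
    Num.max (par_rho_min P) (Num.min (par_r P * it_rho D j) (par_rho_max P));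
  run_x : forall j, it_x D j.+1 = it_xin D j (it_len D j);
  run_y : forall j, it_y D j.+1 = it_yin D j (it_len D j);
  run_restart : forall j, restart j -> it_y0 D j.+1 = it_y0 D 0;
  run_no_restart : forall j, ~ restart j -> it_y0 D j.+1 = it_y D j.+1;
  run_Upsilon : forall j, it_Upsilon D j.+1 =
    Num.max (Num.max (it_Upsilon D j) (f (it_x D j.+1)))
      (min_model j.+1 (it_y0 D j.+1))
}.

End Algorithm.

Definition Umx (R : realType) (n : nat) (L : {set 'I_n}) : 'M[R]_(n, #|L|) :=
  colsub (fun k : 'I_#|L| => enum_val k) 1%:M.

Definition subvec (R : realType) (n : nat) (L : {set 'I_n}) (x : 'cV[R]_n) :
  'cV[R]_#|L| := rowsub (fun k : 'I_#|L| => enum_val k) x.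

Definition Csub (R : realType) (n : nat) (C : set 'cV[R]_n) (L : {set 'I_n}) :
  set 'cV[R]_#|L| := [set w | C (Umx R L *m w)].
Arguments Csub {R n} C L.

(* u = P_S(v). *)
Definition is_proj (R : realType) (m : nat) (S : set 'cV[R]_m)
    (v u : 'cV[R]_m) : Prop :=
  argmin S (fun w => enorm (w - v)) u.

Definition super_support (R : realType) (n s : nat) (x : 'cV[R]_n)
    (L : {set 'I_n}) : Prop :=
  I1 x \subset L /\ #|L| = s.

Definition BF_point (R : realType) (n s : nat) (C : set 'cV[R]_n)
    (f : 'cV[R]_n -> R) (x : 'cV[R]_n) : Prop :=
  [/\ C x, Csparse s x
    & forall L : {set 'I_n}, super_support s x L ->
        exists2 l : R, 0 < l &
          is_proj (Csub C L)
            (subvec L x - l^-1 *: ((Umx R L)^T *m grad f x)) (subvec L x)].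

(* At an isolated point of S the upper limit is that of the empty filter base,
   namely -oo, and every v is a Frechet normal. *)
Definition frechet_normal (R : realType) (n : nat) (S : set 'cV[R]_n)
    (xb : 'cV[R]_n) : set 'cV[R]_n :=
  [set v | (limf_esup (fun x : 'cV[R]_n => (dot v (x - xb) / enorm (x - xb))%:E)
              (within (S `\ xb) (nbhs xb)) <= 0)%E].

Definition mordukhovich_normal (R : realType) (n : nat) (S : set 'cV[R]_n)
    (xb : 'cV[R]_n) : set 'cV[R]_n :=
  [set v | exists (xk vk : nat -> 'cV[R]_n),
     [/\ forall k, S (xk k),
         xk @ \oo --> xb,
         forall k, frechet_normal S (xk k) (vk k)
       & vk @ \oo --> v]].

Definition CCM_stationary (R : realType) (n s : nat) (C : set 'cV[R]_n)
    (f : 'cV[R]_n -> R) (x : 'cV[R]_n) : Prop :=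
  [/\ C x, Csparse s x
    & exists a b, [/\ mordukhovich_normal C x a,
        mordukhovich_normal (Csparse s) x b
      & 0 = grad f x + a + b]].

(* For bounded C, zeta = max {|x| : x \in C}; otherwise zeta >= 1 is arbitrary. *)
Definition zeta_spec (R : realType) (n : nat) (C : set 'cV[R]_n) (zeta : R) :
  Prop :=
  (bounded_set C ->
     (exists2 x, C x & enorm x = zeta) /\ forall x, C x -> enorm x <= zeta) /\
  (~ bounded_set C -> 1 <= zeta).

Definition theta_bar (R : realType) (lmin lmax gamma rho_min : R) : R :=
  (lmax + gamma) / (lmin + rho_min).

(* If C = {0}, then zeta = 0 and gamma / zeta is 0 by convention. *)
Definition kappa_bar (R : realType) (lmin gamma zeta rho_min : R) : R :=
  Num.max 1 (Num.max ((rho_min + gamma) / (lmin + rho_min))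
                     ((rho_min + gamma / zeta) / (lmin + rho_min))).

(* Main.v *)
(* Every model value q_j = Psi_(j+1) involves f only through the gradient at the
   previous iterate: with u = x_(j+1) - x_j and w = x_(j+1) - y_(j+1),
     q_j = u . g(x_j) + u . H u / 2 + rho |w|^2 / 2,
   while the gradient of the model is (g(x_j) + H u + rho w, - rho w).  The bound
   on that gradient therefore controls |w| and |g(x_j)| by |u| + eps_j, so that
   |q_j| <= M (|u| + eps_j)^2.  This is a Lojasiewicz inequality with exponent
   1/2 that holds for the quadratic model whatever f is.  Together with sufficient
   decrease of q it makes the steps |u| summable, hence x_j converges, and so does
   y_j.  In the limit the bound on |g(x_j)| makes g vanish, and a feasible
   critical point of f is BF and CC-M stationary. *)
Require Import Defs.
From HB Require Import structures.
From mathcomp Require Import all_boot all_order all_algebra perm.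
From mathcomp Require Import all_classical all_reals all_analysis.
From mathcomp Require Import ring lra.

Set Implicit Arguments.
Unset Strict Implicit.
Unset Printing Implicit Defensive.

Import Order.TTheory GRing.Theory Num.Theory.
Import numFieldNormedType.Exports.

Local Open Scope classical_set_scope.
Local Open Scope ring_scope.

(** * The Euclidean inner product and norm *)

Section Euclidean.
Context {R : realType} {n : nat}.
Implicit Types (u v w : 'cV[R]_n) (A H : 'M[R]_n).

Lemma dotE u v : dot u v = \sum_i u i 0 * v i 0.
Proof. by rewrite /dot mxE; apply: eq_bigr => i _; rewrite mxE. Qed.

Lemma dotC u v : dot u v = dot v u.
Proof. by rewrite !dotE; apply: eq_bigr => i _; rewrite mulrC. Qed.

Lemma dotDl u v w : dot (u + v) w = dot u w + dot v w.
Proof. by rewrite /dot linearD/= mulmxDl mxE. Qed.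

Lemma dotZl a u v : dot (a *: u) v = a * dot u v.
Proof. by rewrite /dot linearZ/= -scalemxAl mxE. Qed.

Lemma dotNl u v : dot (- u) v = - dot u v.
Proof. by rewrite -scaleN1r dotZl mulN1r. Qed.

Lemma dotDr u v w : dot w (u + v) = dot w u + dot w v.
Proof. by rewrite dotC dotDl !(dotC w). Qed.

Lemma dotZr a u v : dot u (a *: v) = a * dot u v.
Proof. by rewrite dotC dotZl dotC. Qed.

Lemma dotNr u v : dot u (- v) = - dot u v.
Proof. by rewrite dotC dotNl dotC. Qed.

Definition dot_lin := (dotDl, dotDr, dotZl, dotZr, dotNl, dotNr).

Lemma dot_ge0 u : 0 <= dot u u.
Proof. by rewrite dotE sumr_ge0// => i _; rewrite -expr2 sqr_ge0. Qed.

Lemma dot_eq0 u : (dot u u == 0) = (u == 0).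
Proof.
apply/idP/eqP => [|->]; last by rewrite /dot mulmx0 mxE.
rewrite dotE psumr_eq0 => [/allP u0|i _]; last by rewrite -expr2 sqr_ge0.
apply/colP => i; have := u0 i (mem_index_enum i).
by rewrite mxE mulf_eq0 orbb => /eqP.
Qed.

Lemma dot0l u : dot 0 u = 0.
Proof. by rewrite -(scale0r 0) dotZl mul0r. Qed.

Lemma dot_deltal i u : dot (delta_mx i 0) u = u i 0.
Proof.
rewrite dotE (bigD1 i)//= mxE !eqxx mul1r big1 ?addr0// => j /negPf ji.
by rewrite mxE ji mul0r.
Qed.

Lemma dot_sym A u v : A^T = A -> dot u (A *m v) = dot v (A *m u).
Proof. by move=> sA; rewrite dotC /dot trmx_mul sA mulmxA. Qed.

(** The form is nonnegative on all combinations of [u] and [v], which bounds its discriminant.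
    Semidefiniteness is enough, so [A] may be singular, as it is in the Rayleigh argument below. *)
Lemma psd_CauchySchwarz A u v : A^T = A -> (forall w, 0 <= dot w (A *m w)) ->
  dot u (A *m v) ^+ 2 <= dot u (A *m u) * dot v (A *m v).
Proof.
move=> sA psd.
have Q a b : 0 <= a ^+ 2 * dot u (A *m u) + 2 * a * b * dot u (A *m v)
               + b ^+ 2 * dot v (A *m v).
  have := psd (a *: u + b *: v).
  rewrite mulmxDr -!scalemxAr !dot_lin (dot_sym v u sA) => h.
  by rewrite (le_trans h)//; lra.
have := psd u; have := psd v; have := Q.
set x := dot u (A *m u); set y := dot v (A *m v); set z := dot u (A *m v).
move=> {}Q y0 x0.
(* When the form vanishes at [v], the choices of coefficients below force the mixed term [z] to
   vanish as well. *)
have [y1|/eqP y1] := eqVneq y 0.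
  have [x1|/eqP x1] := eqVneq x 0.
    by have := Q 1 (- z); rewrite x1 y1; nra.
  have xp : 0 < x by rewrite lt_neqAle x0 andbT eq_sym; exact/eqP.
  by have := Q z (- x); rewrite y1; nra.
have yp : 0 < y by rewrite lt_neqAle y0 andbT eq_sym; exact/eqP.
(* The minimizing ratio of coefficients, cleared of its denominator [y]. *)
have := Q y (- z).
have -> : y ^+ 2 * x + 2 * y * - z * z + (- z) ^+ 2 * y = y * (x * y - z ^+ 2)
  by ring.
by rewrite pmulr_rge0// subr_ge0.
Qed.

Lemma enorm_ge0 u : 0 <= enorm u.
Proof. exact: sqrtr_ge0. Qed.

Lemma enorm_sqr u : enorm u ^+ 2 = dot u u.
Proof. by rewrite sqr_sqrtr// dot_ge0. Qed.

Lemma enorm0 : enorm (0 : 'cV[R]_n) = 0.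
Proof. by rewrite /enorm dot0l sqrtr0. Qed.

Lemma dot_le_enorm u v : `|dot u v| <= enorm u * enorm v.
Proof.
rewrite -(ler_pXn2r (_ : (0 < 2)%N))// ?nnegrE ?mulr_ge0 ?enorm_ge0//.
rewrite real_normK ?num_real// exprMn !enorm_sqr.
have := @psd_CauchySchwarz 1%:M u v; rewrite !mul1mx trmx1; apply=> // w.
by rewrite mul1mx dot_ge0.
Qed.

Lemma enormD u v : enorm (u + v) <= enorm u + enorm v.
Proof.
rewrite -(ler_pXn2r (_ : (0 < 2)%N))// ?nnegrE ?addr_ge0 ?enorm_ge0//.
rewrite enorm_sqr !dot_lin sqrrD !enorm_sqr (dotC v u).
by have := le_trans (ler_norm _) (dot_le_enorm u v); lra.
Qed.

Lemma enormZ a u : enorm (a *: u) = `|a| * enorm u.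
Proof. by rewrite /enorm !dot_lin mulrA -expr2 sqrtrM ?sqr_ge0// sqrtr_sqr. Qed.

Lemma enormN u : enorm (- u) = enorm u.
Proof. by rewrite -scaleN1r enormZ normrN1 mul1r. Qed.

Lemma coord_le_enorm u i : `|u i 0| <= enorm u.
Proof.
rewrite -sqrtr_sqr ler_wsqrtr// dotE (bigD1 i)//= -expr2 lerDl sumr_ge0// => j _.
by rewrite -expr2 sqr_ge0.
Qed.

Lemma enorm_le_sum u : enorm u <= \sum_i `|u i 0|.
Proof.
have {1}-> : u = \sum_i u i 0 *: delta_mx i 0.
  by rewrite [LHS]matrix_sum_delta; apply: eq_bigr => i _; rewrite big_ord1.
elim/big_ind2 : _ => [|x a y b xa yb|i _]; first by rewrite enorm0.
  by rewrite (le_trans (enormD _ _))// lerD.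
by rewrite enormZ /enorm dot_deltal mxE !eqxx sqrtr1 mulr1.
Qed.

End Euclidean.

(** * Continuity of finite sums and quadratic forms *)

Lemma cvg_bigsum (R : realType) (T : Type) (F : set_system T) {FF : Filter F}
    (I : finType) (f : I -> T -> R) (l : I -> R) :
  (forall i, f i @ F --> l i) -> (fun x => \sum_i f i x) @ F --> \sum_i l i.
Proof.
move=> fl; apply: cvg_big => // z.
by apply: cvgD; [exact: cvg_fst|exact: cvg_snd].
Qed.

(** Row vectors are used because [EVT_max_rV] will be applied to this form on the unit sphere. *)
Lemma continuous_quadratic (R : realType) (n : nat) (A : 'M[R]_n) :
  continuous (fun r : 'rV[R]_n => (r *m A *m r^T) 0 0).
Proof.
rewrite (_ : (fun _ => _) =
  (fun r : 'rV[R]_n => \sum_j (\sum_i r 0 i * A i j) * r 0 j)); last first.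
  apply/funext => t; rewrite mxE; apply: eq_bigr => j _; rewrite !mxE.
  by congr (_ * _); apply: eq_bigr.
move=> r; apply: (@cvg_bigsum _ _ (nbhs r)) => j.
apply: cvgM; last exact: coord_continuous.
apply: (@cvg_bigsum _ _ (nbhs r)) => i.
by apply: cvgM; [exact: coord_continuous|exact: cvg_cst].
Qed.


(** * Rayleigh quotient and operator norm of a positive definite matrix *)

Section Rayleigh.
Context {R : realType} {n : nat}.
Variables (H : 'M[R]_n) (lmax : R).
Hypotheses (Hpos : posdef_sym H) (H_eig : forall a, eigenvalue H a -> a <= lmax).

Let Hsym : H^T = H. Proof. by case: Hpos. Qed.

Lemma posdef_ge0 u : 0 <= dot u (H *m u).
Proof.
have [->|u0] := eqVneq u 0; first by rewrite dot0l.
by apply: ltW; case: Hpos => _; apply.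
Qed.

(* A maximizer of the Rayleigh quotient is an eigenvector. *)
Lemma rayleigh_le u : dot u (H *m u) <= lmax * dot u u.
Proof.
have [->|u0] := eqVneq u 0; first by rewrite !dot0l mulr0.
pose q (r : 'rV[R]_n) := (r *m H *m r^T) 0 0.
pose S := [set r : 'rV[R]_n | (r *m 1%:M *m r^T) 0 0 = 1].
have Sdot (r : 'rV[R]_n) : (r *m 1%:M *m r^T) 0 0 = dot r^T r^T.
  by rewrite /dot mulmx1 trmxK.
have qdot (r : 'rV[R]_n) : q r = dot r^T (H *m r^T).
  by rewrite /dot trmxK mulmxA.
have dot_gt0 (w : 'cV[R]_n) : w != 0 -> 0 < dot w w.
  by move=> w0; rewrite lt_neqAle eq_sym dot_eq0 w0 dot_ge0.
have normalize (w : 'cV[R]_n) : w != 0 -> S ((enorm w)^-1 *: w)^T.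
  move=> w0; rewrite /S/= Sdot trmxK dotZl dotZr mulrA -expr2 exprVn enorm_sqr.
  by rewrite mulVf// dot_eq0.
have Sc : compact S.
  apply: bounded_closed_compact.
    exists 1; split => // M M1 r /= r1; rewrite /Num.norm/= mx_normrE.
    apply: (bigmax_le _ (ltW (lt_trans ltr01 M1))) => -[i j] _ /=.
    rewrite (le_trans _ (ltW M1))// ord1.
    have := coord_le_enorm r^T j; rewrite mxE => /le_trans; apply.
    by rewrite /enorm -Sdot r1 sqrtr1.
  apply: (@preimage_closed _ _ _ [set x : R | x = 1]); last exact: closed_eq.
  by move=> r _; exact: continuous_quadratic.
have [||r] := @EVT_max_rV R n q S _ Sc.
- by exists ((enorm u)^-1 *: u)^T; exact: normalize.
- by apply: continuous_subspaceT; exact: continuous_quadratic.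
rewrite inE => Sr rmax.
(* Homogeneity extends the maximum over the unit sphere to all vectors. *)
have qle w : dot w (H *m w) <= q r * dot w w.
  have [->|w0] := eqVneq w 0; first by rewrite !dot0l mulr0.
  have := rmax _ (mem_set (normalize _ w0)).
  rewrite [X in X <= _]qdot trmxK -scalemxAr dotZl dotZr mulrA -expr2 exprVn.
  by rewrite enorm_sqr mulrC ler_pdivrMr ?dot_gt0.
suff qr : eigenvalue H (q r).
  apply: le_trans (qle u) _; apply: ler_wpM2r; [exact: dot_ge0|exact: H_eig].
(* By maximality [A] is positive semidefinite, and its form vanishes at [r^T]; Cauchy-Schwarz for
   [A] then gives [A *m r^T = 0]. *)
pose A := (q r)%:M - H.
have dotA (v w : 'cV[R]_n) : dot v (A *m w) = q r * dot v w - dot v (H *m w).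
  by rewrite mulmxBl mul_scalar_mx dotDr dotNr dotZr.
have Asym : A^T = A by rewrite linearB/= tr_scalar_mx Hsym.
have Ar : A *m r^T = 0.
  apply/eqP; rewrite -dot_eq0 -sqrf_eq0 eq_le sqr_ge0 andbT.
  have := @psd_CauchySchwarz _ _ A (A *m r^T) r^T Asym.
  rewrite [X in _ * X]dotA -Sdot Sr -qdot mulr1 subrr mulr0; apply => w.
  by rewrite dotA subr_ge0.
(* Eigenvectors here are row vectors; symmetry of [H] transposes the equation. *)
apply/eigenvalueP; exists r; last first.
  by apply: contra_eq_neq Sr => ->; rewrite !mul0mx mxE eq_sym oner_neq0.
apply: trmx_inj; rewrite trmx_mul Hsym linearZ/=.
by move/eqP: Ar; rewrite mulmxBl mul_scalar_mx subr_eq0 => /eqP.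
Qed.

(** With [v = H *m u], Cauchy-Schwarz for [H] bounds the square of [dot v v] by the product of the
    forms at [v] and [u]. The Rayleigh bound applies to both factors, and one [dot v v] cancels. *)
Lemma enorm_posdef_le u : enorm (H *m u) <= lmax * enorm u.
Proof.
have [->|u0] := eqVneq u 0; first by rewrite mulmx0 enorm0 mulr0.
have l0 : 0 <= lmax.
  have := le_trans (posdef_ge0 u) (rayleigh_le u).
  by rewrite pmulr_lge0// lt_neqAle eq_sym dot_eq0 u0 dot_ge0.
rewrite -(ler_pXn2r (_ : (0 < 2)%N))// ?nnegrE ?mulr_ge0 ?enorm_ge0//.
rewrite exprMn !enorm_sqr; set v := H *m u.
have [->|v0] := eqVneq v 0.
  by rewrite dot0l mulr_ge0 ?sqr_ge0 ?dot_ge0.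
have vv : 0 < dot v v by rewrite lt_neqAle eq_sym dot_eq0 v0 dot_ge0.
rewrite -(ler_pM2l vv).
have := psd_CauchySchwarz v u Hsym posdef_ge0; rewrite -/v.
rewrite expr2 => /le_trans; apply.
rewrite (_ : _ * (_ * _) = (lmax * dot v v) * (lmax * dot u u)); last by ring.
apply: ler_pM; rewrite ?rayleigh_le ?posdef_ge0//; exact: posdef_ge0.
Qed.

End Rayleigh.

(** * Convergence of vector sequences and summability of steps *)

Lemma cvg_colP (R : realType) (n : nat) (u : nat -> 'cV[R]_n) (l : 'cV[R]_n) :
  (forall i, (fun k => u k i 0) @ \oo --> l i 0) -> u @ \oo --> l.
Proof.
move=> ul; apply/cvgrPdist_le => /= e e0; near=> k.
rewrite /Num.norm/= mx_normrE (bigmax_le _ (ltW e0))//= => -[i j] _.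
rewrite (ord1 j) !mxE/=.
move: i {j}; near: k; apply: filter_forall => /= i.
exact: ((cvgrPdist_le _ _).1 (ul i)).
Unshelve. all: by end_near. Qed.

Lemma cvg_coord (R : realType) (n : nat) (u : nat -> 'cV[R]_n) (l : 'cV[R]_n) i :
  u @ \oo --> l -> (fun k => u k i 0) @ \oo --> l i 0.
Proof.
move=> ul; apply: (@cvg_comp _ _ _ u (fun M : 'cV[R]_n => M i 0) _ _ _ ul).
exact: coord_continuous.
Qed.

Lemma squeeze_cvg0 (R : realType) (u v : R^nat) :
  (forall k, `|u k| <= v k) -> v @ \oo --> 0 -> u @ \oo --> 0.
Proof.
move=> uv v0; apply: norm_cvg0.
apply: (@squeeze_cvgr _ _ _ _ (cst 0) _ _ _ _ _ v0) => //; last exact: cvg_cst.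
by apply: nearW => k /=; rewrite normr_ge0 uv.
Qed.

Lemma cvg_enorm0 (R : realType) (n : nat) (u : nat -> 'cV[R]_n) (l : 'cV[R]_n) :
  (fun k => enorm (u k - l)) @ \oo --> 0 -> u @ \oo --> l.
Proof.
move=> ul; apply: cvg_colP => i; apply/subr_cvg0; apply: squeeze_cvg0 ul => k.
by have := coord_le_enorm (u k - l) i; rewrite !mxE.
Qed.

Lemma enorm_cvg0 (R : realType) (n : nat) (u : nat -> 'cV[R]_n) (l : 'cV[R]_n) :
  u @ \oo --> l -> (fun k => enorm (u k - l)) @ \oo --> 0.
Proof.
move=> ul.
have s0 : (fun k => \sum_i `|(u k - l) i 0|) @ \oo --> \sum_(i < n) (0 : R).
  apply: (@cvg_bigsum _ _ \oo) => i; rewrite -(normr0 R); apply: cvg_norm.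
  rewrite [X in X @ _](_ : _ = (fun k => u k i 0 - l i 0)).
    by apply/subr_cvg0; exact: cvg_coord.
  by apply/funext => k; rewrite !mxE.
rewrite big1// in s0.
apply: squeeze_cvg0 s0 => k.
by rewrite ger0_norm ?enorm_ge0// enorm_le_sum.
Qed.

(** In each coordinate the telescoping series converges absolutely, being dominated by the step
    lengths. *)
Lemma cvgn_finite_length (R : realType) (n : nat) (x : nat -> 'cV[R]_n) :
  cvgn (series (fun j => enorm (x j.+1 - x j))) -> cvgn x.
Proof.
move=> len.
have xc i : cvgn (fun j => x j i 0).
  have tc : cvgn (series (telescope (fun j => x j i 0))).
    apply: normed_cvg; apply: series_le_cvg len => j //=; first exact: enorm_ge0.
    by have := coord_le_enorm (x j.+1 - x j) i; rewrite !mxE.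
  rewrite (_ : (fun j => _) =
    (fun j => x 0%N i 0 + series (telescope (fun j => x j i 0)) j)).
    by apply: is_cvgD => //; exact: is_cvg_cst.
  by apply/funext => j; rewrite {1}(eq_sum_telescope (fun j => x j i 0)).
apply/cvg_ex; exists (\col_i limn (fun j => x j i 0)).
by apply: cvg_colP => i; rewrite mxE; exact: xc.
Qed.

(* The Kurdyka-Lojasiewicz argument with exponent 1/2: the square root of the
   values q desingularizes, so its telescoping differences control the steps a. *)
Lemma summable_steps (R : realType) (a e q : R^nat) (delta M B : R) :
  0 < delta -> 0 <= M -> (forall j, 0 <= a j) -> (forall j, 0 <= e j) ->
  cvgn (series e) -> (forall j, a j + e j <= B) ->
  (forall j, delta * a j.+1 ^+ 2 <= q j - q j.+1) ->
  (forall j, `|q j| <= M * (a j + e j) ^+ 2) ->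
  cvgn (series a).
Proof.
move=> delta0 M0 a0 e0 esum aeB desc qM.
have qdec : nonincreasing_seq q.
  apply/nonincreasing_seqP => j; rewrite -subr_ge0.
  by apply: le_trans (desc j); rewrite mulr_ge0 ?sqr_ge0 ?ltW.
(* The lower bound comes from [qM] and the uniform bound [B]. *)
have qcvg : cvgn q.
  apply: nonincreasing_is_cvgn => //; exists (- (M * B ^+ 2)) => _ [j _ <-].
  have /ler_normlP[+ _] := qM j; rewrite lerNl; apply: le_trans.
  rewrite lerN2 ler_wpM2l// lerXn2r ?nnegrE ?addr_ge0//.
  by rewrite (le_trans _ (aeB j)) ?addr_ge0.
have qS : (fun j => q j.+1) @ \oo --> limn q by rewrite cvg_shiftS.
have a_cvg0 : a @ \oo --> 0.
  rewrite -cvg_shiftS.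
  have a2 : (fun j => a j.+1 ^+ 2) @ \oo --> 0.
    apply: (@squeeze_cvg0 _ _ (fun j => (q j - q j.+1) / delta)) => [j|].
      by rewrite ger0_norm ?sqr_ge0// ler_pdivlMr// mulrC.
    rewrite -(mul0r delta^-1) -(subrr (limn q)).
    by apply: cvgM; [exact: cvgB|exact: cvg_cst].
  rewrite [X in X @ _](_ : _ = (fun j => Num.sqrt (a j.+1 ^+ 2))).
    have := cvg_comp _ _ a2 (@sqrt_continuous R 0); rewrite sqrtr0; exact.
  by apply/funext => j; rewrite sqrtr_sqr ger0_norm.
have q_cvg0 : q @ \oo --> 0.
  apply: squeeze_cvg0 qM _.
  have ae : (fun j => a j + e j) @ \oo --> 0.
    by rewrite -(addr0 0); apply: cvgD => //; exact: cvg_series_cvg_0.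
  rewrite -(mulr0 M); apply: cvgM; first exact: cvg_cst.
  by rewrite -(mulr0 0); apply: cvgM.
(* A nonincreasing sequence with limit 0 is nonnegative, so the square roots [p j] are genuine and
   not the default value 0. *)
have q0 j : 0 <= q j.
  by rewrite -(cvg_lim _ q_cvg0)//; exact: nonincreasing_cvgn_ge.
pose p j := Num.sqrt (q j); pose N := Num.sqrt M / delta.
have N0 : 0 <= N by rewrite divr_ge0 ?sqrtr_ge0// ltW.
have p0 j : 0 <= p j by exact: sqrtr_ge0.
have pdec j : p j.+1 <= p j by apply: ler_wsqrtr; exact: qdec.
have pae j : p j <= Num.sqrt M * (a j + e j).
  rewrite -[a j + e j]ger0_norm ?addr_ge0// -sqrtr_sqr -sqrtrM//.
  by apply: ler_wsqrtr; exact: le_trans (ler_norm _) (qM j).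
(* With [d = p j - p j.+1], factoring [q j - q j.+1] as a difference of squares gives
   [a j.+1 ^+ 2 <= 2 * N * d * w], which is at most [(w / 2 + N * d) ^+ 2] by the
   arithmetic-geometric mean inequality. *)
have step j : 2 * a j.+1 + 2 * N * p j.+1 <= a j + e j + 2 * N * p j.
  set w := a j + e j; have w0 : 0 <= w by rewrite addr_ge0.
  suff : a j.+1 <= w / 2 + N * (p j - p j.+1) by lra.
  have d0 : 0 <= p j - p j.+1 by rewrite subr_ge0.
  have rhs0 : 0 <= w / 2 + N * (p j - p j.+1).
    by rewrite addr_ge0 ?divr_ge0// mulr_ge0.
  rewrite -(ler_pXn2r (_ : (0 < 2)%N))// ?nnegrE//.
  have a2 : a j.+1 ^+ 2 <= 2 * N * (p j - p j.+1) * w.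
    have -> : 2 * N * (p j - p j.+1) * w =
        (p j - p j.+1) * (2 * (Num.sqrt M * w)) / delta by rewrite /N; ring.
    rewrite ler_pdivlMr// mulrC; apply: le_trans (desc j) _.
    rewrite -[q j]sqr_sqrtr// -[q j.+1]sqr_sqrtr// -/(p _) -/(p _) subr_sqr.
    apply: ler_wpM2l => //; have := pae j; have := pdec j; rewrite -/w; lra.
  apply: le_trans a2 _; rewrite -subr_ge0.
  rewrite [X in 0 <= X](_ : _ = (w / 2 - N * (p j - p j.+1)) ^+ 2).
    exact: sqr_ge0.
  by field.
(* Of the two copies of [a j.+1] in [step], one enters the partial sum and the other pays for the
   right-hand side at the next index. *)
have sum_le m : series a m.+1 + (a m + 2 * N * p m)
    <= a 0%N + (a 0%N + 2 * N * p 0%N) + series e m.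
  elim: m => [|m IH]; first by rewrite !seriesEnat/= big_nat1 big_geq// addr0.
  rewrite seriesS/= [series e _]seriesS/=.
  by have := step m; lra.
apply: nondecreasing_is_cvgn.
  by apply/nondecreasing_seqP => m; rewrite seriesS lerDr.
exists (a 0%N + (a 0%N + 2 * N * p 0%N) + limn (series e)) => _ [m _ <-].
apply: le_trans (_ : series a m.+1 + (a m + 2 * N * p m) <= _).
  have : 0 <= N * p m by rewrite mulr_ge0.
  by rewrite seriesS; have := a0 m; lra.
apply: le_trans (sum_le m) _; rewrite lerD2l.
apply: nondecreasing_cvgn_le => //.
by apply/nondecreasing_seqP => k; rewrite seriesS lerDr.
Qed.

(** * Partial gradients of the quadratic model *)

Lemma derive_along_quadratic (R : realType) (V : normedModType R) (h : V -> R)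
    (x v : V) (a b : R) :
  (forall t, h (t *: v + x) = h x + t * a + t ^+ 2 * b) -> 'D_v h x = a.
Proof.
move=> hE; apply: cvg_lim => //.
(* For [t != 0] the difference quotient is exactly [a + t * b]. *)
have lin : (fun t : R => a + t * b) @ 0^' --> a.
  rewrite -[X in _ --> X]addr0 -[X in _ + X](mul0r b).
  apply: cvg_within_filter.
  by apply: cvgD; [exact: cvg_cst|apply: cvgM; [exact: cvg_id|exact: cvg_cst]].
apply: cvg_trans lin; apply: near_eq_cvg; near=> t.
have t0 : t != 0 by near: t; exact: nbhs_dnbhs_neq.
by rewrite /= hE /GRing.scale/=; field.
Unshelve. all: by end_near. Qed.

Section ModelGradient.
Context {R : realType} {n : nat}.
Variables (f : 'cV[R]_n -> R) (H : 'M[R]_n) (rho : R) (z : 'cV[R]_n).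
Hypothesis Hsym : H^T = H.

Lemma grad_x_Phi x y : grad_x (Phi f H rho z) x y =
  grad f z + H *m (x - z) + rho *: (x - y).
Proof.
apply/colP => i; rewrite mxE.
set d := delta_mx i 0.
(* The two witnesses are the coefficients of [t] and [t ^+ 2] in the model along [d]. *)
rewrite (@derive_along_quadratic _ _ _ _ _
  (dot d (grad f z + H *m (x - z) + rho *: (x - y)))
  (2^-1 * dot d (H *m d) + 2^-1 * rho * dot d d)); first exact: dot_deltal.
move=> t; rewrite /Phi -!(addrA (t *: d)) !enorm_sqr.
rewrite !(mulmxDr, mulmxN) -scalemxAr !dot_lin.
rewrite (dot_sym x d Hsym) (dot_sym z d Hsym) (dotC x d) (dotC y d) (dotC y x).
by field.
Qed.

Lemma grad_y_Phi x y : grad (Phi f H rho z x) y = rho *: (y - x).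
Proof.
apply/colP => i; rewrite mxE.
set d := delta_mx i 0.
rewrite (@derive_along_quadratic _ _ _ _ _ (dot d (rho *: (y - x)))
  (2^-1 * rho * dot d d)); first exact: dot_deltal.
move=> t; rewrite /Phi !enorm_sqr opprD addrCA !dot_lin.
rewrite (dotC x d) (dotC y d) (dotC y x).
by field.
Qed.

End ModelGradient.

(** * Block vectors, limits of sparse vectors and compact sets *)

Lemma enorm_col_mx (R : realType) (m n : nat) (u : 'cV[R]_m) (v : 'cV[R]_n) :
  enorm (col_mx u v) ^+ 2 = enorm u ^+ 2 + enorm v ^+ 2.
Proof. by rewrite !enorm_sqr /dot tr_col_mx mul_row_col mxE. Qed.

Lemma enorm_le_col_mx (R : realType) (m n : nat) (u : 'cV[R]_m) (v : 'cV[R]_n) :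
  enorm u <= enorm (col_mx u v) /\ enorm v <= enorm (col_mx u v).
Proof.
split; rewrite -(ler_pXn2r (_ : (0 < 2)%N))// ?nnegrE ?enorm_ge0// enorm_col_mx.
  by rewrite lerDl sqr_ge0.
by rewrite lerDr sqr_ge0.
Qed.

(** Nonzero coordinates of the limit are eventually nonzero along the sequence, so the support of
    [l] lies in that of some [y k]. *)
Lemma Csparse_cvg (R : realType) (n s : nat) (y : nat -> 'cV[R]_n) l :
  (forall k, Csparse s (y k)) -> y @ \oo --> l -> Csparse s l.
Proof.
move=> ys yl.
have /filter_ex[k supp] :
    \forall k \near \oo, forall i, l i 0 != 0 -> y k i 0 != 0.
  apply: filter_forall => i; have [li|li] := eqVneq (l i 0) 0.
    by apply: nearW => k.
  have /cvgr_neq0/(_ li) := cvg_coord (i := i) yl.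
  by apply: filterS.
apply: leq_trans (ys k); apply/subset_leq_card/fintype.subsetP => i.
by rewrite !inE; exact: supp.
Qed.

Lemma compact_enorm_bounded (R : realType) (n : nat)
    (K : set ('cV[R]_n * 'cV[R]_n)) :
  compact K -> exists B, forall z, K z -> enorm z.1 <= B.
Proof.
move=> Kc.
have : compact (fst @` K).
  apply: continuous_compact => //; apply: continuous_subspaceT => z.
  exact: cvg_fst.
move=> /compact_bounded/pinfty_ex_gt0[M M0 KM]; exists (\sum_(i < n) M) => z Kz.
apply: le_trans (enorm_le_sum _) _; apply: ler_sum => i _.
apply: le_trans (KM _ (imageP fst Kz)).
rewrite [leRHS]/Num.norm/= mx_normrE.
exact: (le_bigmax _ (fun j : 'I_n * 'I_1 => `|z.1 j.1 j.2|) (i, 0)).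
Qed.

(** * Stationarity of feasible critical points *)

Section Stationarity.
Context {R : realType} {n : nat}.
Variables (s : nat) (C : set 'cV[R]_n) (f : 'cV[R]_n -> R) (x : 'cV[R]_n).
Hypotheses (Cx : C x) (sx : Csparse s x) (gx : grad f x = 0).

Lemma Umx_subvec (L : {set 'I_n}) : I1 x \subset L -> Umx R L *m subvec L x = x.
Proof.
move=> xL; apply/colP => i; rewrite mxE.
have [iL|iL] := boolP (i \in L); last first.
  have xi : x i 0 = 0.
    by apply/eqP; apply: contraNT iL => xi; apply: (fintype.subsetP xL); rewrite inE.
  rewrite xi big1// => k _; rewrite !mxE; case: eqP => [ik|_]; last by rewrite mul0r.
  by rewrite -ik xi mulr0.
rewrite (bigD1 (enum_rank_in iL i))//= !mxE enum_rankK_in// eqxx mul1r.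
rewrite big1 ?addr0// => k kneq; rewrite !mxE.
case: eqP => [ik|_]; last by rewrite mul0r.
by case/eqP: kneq; apply: enum_val_inj; rewrite enum_rankK_in.
Qed.

(** With zero gradient the point to be projected is [subvec L x], which already lies in [Csub C L];
    any step size works, and 1 is chosen. *)
Lemma BF_point_of_grad0 : BF_point s C f x.
Proof.
split=> // L [xL _]; exists 1 => //; rewrite gx mulmx0 scaler0 subr0; split.
  by rewrite /Csub/= Umx_subvec.
by move=> w _; rewrite subrr enorm0 enorm_ge0.
Qed.

Lemma mordukhovich_normal0 (S : set 'cV[R]_n) : S x -> mordukhovich_normal S x 0.
Proof.
move=> Sx; exists (fun=> x), (fun=> 0); split => //; try exact: cvg_cst.
(* The upper limit is an infimum of suprema over the sets of the filter; the whole space already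
   gives a supremum at most 0, also when [x] is isolated in [S]. *)
move=> _; apply: le_trans (_ : ereal_sup [set (dot 0 (y - x) / enorm (y - x))%:E
  | y in setT] <= 0)%E.
  by apply: ereal_inf_lbound; exists setT => //; exact: filterT.
by apply: ge_ereal_sup => _ [y _ <-]; rewrite dot0l mul0r.
Qed.

Lemma CCM_stationary_of_grad0 : CCM_stationary s C f x.
Proof.
split=> //; exists 0, 0; split; try exact: mordukhovich_normal0.
by rewrite gx !addr0.
Qed.

End Stationarity.

(** * Bounds on the gradient of [f] and on the model value *)

Section ModelEstimates.
Context {R : realType} {n : nat}.
Variables (f : 'cV[R]_n -> R) (H : 'M[R]_n) (lmax rho rho_min G : R).
Variables (z x y : 'cV[R]_n).
Hypotheses (Hpos : posdef_sym H) (H_eig : forall a, eigenvalue H a -> a <= lmax).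
Hypotheses (rho_min_gt0 : 0 < rho_min) (rho_ge : rho_min <= rho).
Hypothesis gradG : enorm (grad_xy (Phi f H rho z) x y) <= G.

Let g_x : enorm (grad f z + H *m (x - z) + rho *: (x - y)) <= G.
Proof.
rewrite -grad_x_Phi; last by case: Hpos.
exact: le_trans (enorm_le_col_mx _ _).1 gradG.
Qed.

Let g_y : enorm (rho *: (x - y)) <= G.
Proof.
rewrite -enormN -scalerN opprB -(grad_y_Phi f H rho z).
exact: le_trans (enorm_le_col_mx _ _).2 gradG.
Qed.

(** The x-block of the model gradient is solved for [grad f z]; one [G] bounds that block, the other
    the penalty term, which is the y-block up to sign. *)
Lemma enorm_grad_le : enorm (grad f z) <= 2 * G + lmax * enorm (x - z).
Proof.
have -> : grad f z = (grad f z + H *m (x - z) + rho *: (x - y))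
    + (- (rho *: (x - y)) + - (H *m (x - z))).
  by rewrite addrA !addrK.
apply: le_trans (enormD _ _) _.
rewrite (_ : 2 * G + _ = G + (G + lmax * enorm (x - z))); last by ring.
apply: lerD => //; apply: le_trans (enormD _ _) _; rewrite !enormN.
by apply: lerD => //; exact: enorm_posdef_le.
Qed.

(** Eliminating [grad f z] through the x-block turns [1/2] into [-1/2] before the [H] term and
    leaves only terms of second order in [enorm (x - z)] and [G]. *)
Lemma normr_Phi_le : `|Phi f H rho z x y| <=
  2 * enorm (x - z) * G + lmax / 2 * enorm (x - z) ^+ 2 + G ^+ 2 / (2 * rho_min).
Proof.
have rho0 : 0 < rho by exact: lt_le_trans rho_ge.
have -> : Phi f H rho z x y =
    dot (x - z) (grad f z + H *m (x - z) + rho *: (x - y))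
    - dot (x - z) (rho *: (x - y)) - 2^-1 * dot (x - z) (H *m (x - z))
    + 2^-1 * rho * enorm (x - y) ^+ 2.
  by rewrite /Phi !dotDr; field.
set u := x - z; set d := grad f z + _ + _; set w := rho *: (x - y).
have w2 : 2^-1 * rho * enorm (x - y) ^+ 2 <= G ^+ 2 / (2 * rho_min).
  have -> : 2^-1 * rho * enorm (x - y) ^+ 2 = enorm w ^+ 2 / (2 * rho).
    by rewrite /w enormZ gtr0_norm//; field; rewrite gt_eqF.
  apply: ler_pM; rewrite ?sqr_ge0 ?invr_ge0 ?mulr_ge0 ?(ltW rho0)//.
    by rewrite lerXn2r// nnegrE ?enorm_ge0// (le_trans (enorm_ge0 _) g_y).
  by rewrite lef_pV2 ?posrE ?mulr_gt0// ler_wpM2l.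
have w0 : 0 <= 2^-1 * rho * enorm (x - y) ^+ 2.
  by rewrite mulr_ge0 ?sqr_ge0 ?mulr_ge0// ltW.
have du : `|dot u d| <= enorm u * G.
  by apply: le_trans (dot_le_enorm _ _) _; rewrite ler_wpM2l ?enorm_ge0.
have dw : `|dot u w| <= enorm u * G.
  by apply: le_trans (dot_le_enorm _ _) _; rewrite ler_wpM2l ?enorm_ge0.
have H0 := posdef_ge0 Hpos u; have H1 := rayleigh_le Hpos H_eig u.
move: H1 du dw; rewrite -enorm_sqr !ler_norml => H1 /andP[? ?] /andP[? ?].
by apply/andP; split; lra.
Qed.

End ModelEstimates.

(** * Convergence of the outer iterates and stationarity of the limit *)

Theorem theorem5 (R : realType) (n s : nat) (hs : (0 < s < n)%N)
  (C : set 'cV[R]_n) (p : 'cV[R]_n -> 'cV[R]_n) (f : 'cV[R]_n -> R)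
  (P : pdqn_params R) (D : pdqn_iterates R n)
  (C_closed : closed C) (C_convex : convex_set C) (C_sym : symmetric_with C p)
  (f_C2 : twice_continuously_differentiable f)
  (run : pdqn_run s C p f P D)
  (zeta lmin lmax gamma c : R)
  (zetaP : zeta_spec C zeta)
  (lmin_gt0 : 0 < lmin) (lmin_le : lmin <= lmax)
  (gamma_gt0 : 0 < gamma) (c_gt0 : 0 < c)
  (H_eig : forall j a, eigenvalue (it_H D j) a -> lmin <= a <= lmax)
  (g_near : forall x, enorm x <= c * zeta -> enorm (grad f x) <= gamma)
  (g_far : forall x, c * zeta < enorm x -> enorm (grad f x) <= gamma * enorm x)
  (rho_bounds : forall j, par_rho_min P <= it_rho D j <= par_rho_max P)
  (rho_min_big : lmax + gamma - lmin < par_rho_min P)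
  (kappa_small : kappa_bar lmin gamma zeta (par_rho_min P)
                   < c * (1 - theta_bar lmin lmax gamma (par_rho_min P)))
  (K : set ('cV[R]_n * 'cV[R]_n)) (K_compact : compact K)
  (K_iter : forall j, K (it_x D j, it_y D j))
  (Psi : nat -> R)
  (PsiE : forall j, Psi j.+1 = model f D j (it_x D j.+1) (it_y D j.+1))
  (eps_summable : cvgn (series (par_eps P)))
  (delta kappa : R) (delta_gt0 : 0 < delta) (kappa_ge0 : 0 <= kappa)
  (descent : forall j, (1 <= j)%N ->
     delta * enorm (it_x D j.+1 - it_x D j) ^+ 2 <= Psi j - Psi j.+1)
  (grad_bound : forall j, (1 <= j)%N ->
     enorm (grad_xy (model f D j.-1) (it_x D j) (it_y D j))
       <= kappa * enorm (it_x D j - it_x D j.-1) + par_eps P j.-1)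
  (gap : (fun j => enorm (it_x D j - it_y D j)) @ \oo --> (0 : R)) :
  exists xs ys : 'cV[R]_n,
    [/\ (fun j => (it_x D j, it_y D j)) @ \oo --> (xs, ys),
        xs = ys,
        BF_point s C f xs
      & CCM_stationary s C f xs].
Proof.
have [rho_min0 eps_mono eps_cvg] : [/\ 0 < par_rho_min P,
    nonincreasing_seq (par_eps P) & par_eps P @ \oo --> (0 : R)].
  by case: run => -[? ? ? ? ? [? ?] ?].
set x := it_x D; set y := it_y D; set e := par_eps P.
(* The shift in [q] is needed because [PsiE] says nothing about [Psi 0]. *)
pose a j := enorm (x j.+1 - x j); pose q j := Psi j.+1.
have a0 j : 0 <= a j by exact: enorm_ge0.
have e0 j : 0 <= e j.
  rewrite -(cvg_lim _ eps_cvg)//; apply: nonincreasing_cvgn_ge => //.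
  by apply/cvg_ex; exists 0.
have eig j t : eigenvalue (it_H D j) t -> t <= lmax by move=> /H_eig/andP[].
have lmax0 : 0 <= lmax by apply: ltW; exact: lt_le_trans lmin_le.
have rho_ge j : par_rho_min P <= it_rho D j by case/andP: (rho_bounds j).
have Hpos := run_H run.
have gradG j : enorm (grad_xy (model f D j) (x j.+1) (y j.+1)) <= kappa * a j + e j.
  exact: (@grad_bound j.+1 isT).
have [B KB] := compact_enorm_bounded K_compact.
have a_bounded j : a j + e j <= B + B + e 0%N.
  rewrite lerD ?eps_mono//; apply: le_trans (enormD _ _) _; rewrite enormN.
  by apply: lerD; [exact: KB _ (K_iter j.+1)|exact: KB _ (K_iter j)].
(* [b] dominates both coefficients in [kappa * a j + e j]; [M] collects the coefficients of
   [normr_Phi_le] with [G = b * t] and [enorm (x - z) <= t], where [t = a j + e j]. *)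
pose b := kappa + 1.
pose M := 2 * b + lmax / 2 + b ^+ 2 / (2 * par_rho_min P).
have b0 : 0 <= b by rewrite addr_ge0.
have M0 : 0 <= M.
  by rewrite !addr_ge0 ?mulr_ge0 ?sqr_ge0 ?invr_ge0 ?mulr_ge0 ?(ltW rho_min0).
have qM j : `|q j| <= M * (a j + e j) ^+ 2.
  have Gb : kappa * a j + e j <= b * (a j + e j).
    by have := a0 j; have := e0 j; rewrite /b; nra.
  rewrite /q PsiE; have := normr_Phi_le (Hpos j) (@eig j) rho_min0
    (rho_ge j) (le_trans (gradG j) Gb).
  rewrite -/(model _ _ _) -/(a j) => /le_trans; apply.
  set t := a j + e j; have at_ : a j <= t by rewrite lerDl.
  have t0 : 0 <= t by rewrite addr_ge0.
  have -> : M * t ^+ 2 = 2 * t * (b * t) + lmax / 2 * t ^+ 2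
      + (b * t) ^+ 2 / (2 * par_rho_min P).
    by rewrite /M; field; rewrite gt_eqF.
  rewrite lerD2r; apply: lerD; first by rewrite !ler_wpM2r ?mulr_ge0// ler_wpM2l.
  by rewrite ler_wpM2l ?divr_ge0// lerXn2r// nnegrE.
have sum_a : cvgn (series a).
  apply: (summable_steps delta_gt0 M0 a0 e0 eps_summable a_bounded _ qM) => j.
  exact: descent.
have /cvg_ex[xs x_cvg] := cvgn_finite_length sum_a.
have a_cvg0 : a @ \oo --> 0 by exact: cvg_series_cvg_0.
have y_cvg : y @ \oo --> xs.
  apply: cvg_enorm0.
  apply: (@squeeze_cvg0 _ _ (fun j => enorm (x j - y j) + enorm (x j - xs))) => [j|].
    rewrite ger0_norm ?enorm_ge0// -(enormN (x j - y j)) opprB.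
    by rewrite (le_trans _ (enormD _ _))// addrA subrK.
  by rewrite -(addr0 0); apply: cvgD => //; exact: enorm_cvg0.
(* The gradients at [x j] tend to [grad f xs] by continuity, and to 0 by [enorm_grad_le]. *)
have g0 : grad f xs = 0.
  have g_cvg : (fun j => grad f (x j)) @ \oo --> grad f xs.
    apply: (@cvg_comp _ _ _ x (grad f) _ _ _ x_cvg).
    by apply: differentiable_continuous; case: f_C2.
  suff g_cvg0 : (fun j => grad f (x j)) @ \oo --> (0 : 'cV[R]_n).
    exact: (cvg_unique _ g_cvg g_cvg0).
  apply: cvg_enorm0.
  apply: (@squeeze_cvg0 _ _ (fun j => 2 * (kappa * a j + e j) + lmax * a j)) => [j|].
    rewrite subr0 ger0_norm ?enorm_ge0//.
    exact: (enorm_grad_le (Hpos j) (@eig j) (gradG j)).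
  rewrite [X in _ --> X](_ : _ = 2 * (kappa * 0 + 0) + lmax * 0); last by ring.
  have cZ (t : R) (v : R^nat) (m : R) :
      v @ \oo --> m -> (fun j => t * v j) @ \oo --> t * m.
    by move=> vm; apply: cvgM => //; exact: cvg_cst.
  by apply: cvgD; apply: (cZ _ _ _) => //; apply: cvgD => //; exact: (cZ _ _ _).
(* Since [it_len] is positive, each later [y j] is the output of a last inner step, a minimizer over
   feasible points. *)
have y_feas j : C (y j) /\ Csparse s (y j).
  case: j => [|j]; first exact: (run_y_feas run).
  rewrite /y (run_y run); have := run_len run j.
  case: (it_len D j) (run_inner_step run (j := j)) => // l step _.
  by have [_ [pi [i [_ _ [[? ? _] _]]]]] := step l (ltnSn l).
have Cxs : C xs.
  by apply: (closed_cvg _ C_closed _ _ y_cvg); apply: nearW => j; have [] := y_feas j.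
have sxs : Csparse s xs by apply: Csparse_cvg y_cvg => j; have [] := y_feas j.
exists xs, xs; split => //.
- exact: (cvg_pair x_cvg y_cvg).
- exact: BF_point_of_grad0.
- exact: CCM_stationary_of_grad0.
Qed.
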